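(* Let $\varphi$ be a minimal substitution on a finite alphabet $\mathcal{A}$, with non-empty minimal subshift $X_\varphi$. Then there exist a finite alphabet $\mathcal{Z}$ and a primitive substitution $\theta$ on $\mathcal{Z}$ such that $X_\theta$ is topologically conjugate to $X_\varphi$ (that is, there is a homeomorphism $X_\theta \to X_\varphi$ commuting with the shift maps).
   Context: For a finite alphabet $\mathcal{A}$, $\mathcal{A}^+$ is the set of non-empty finite words and $\mathcal{A}^*=\mathcal{A}^+\cup\{\epsilon\}$ with $\epsilon$ the empty word. A substitution on $\mathcal{A}$ is a function $\varphi:\mathcal{A}\to\mathcal{A}^+$, extended to words by concatenation. A word $u$ is admitted by $\varphi$ if it is a subword (block of consecutive letters) of $\varphi^k(a)$ for some $a\in\mathcal{A}$ and $k\ge 0$. The subshift $X_\varphi\subset\mathcal{A}^{\mathbb{Z}}$ is the set of bi-infinite sequences all of whose finite subwords are admitted by $\varphi$, with the topology inherited from the product topology and the shift map $\sigma(w)_i=w_{i+1}$. $\varphi$ is primitive if there is a positive integer $p$ such that for all $a,a'\in\mathcal{A}$ the letter $a'$ appears in $\varphi^p(a)$. A non-empty subset $L\subseteq X_\varphi$ is a minimal component if $L=\overline{\{\sigma^i(w): i\in\mathbb{Z}\}}$ for every $w\in L$. If $X_\varphi$ is a minimal component of itself then $\varphi$ and $X_\varphi$ are called minimal. *)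

(* Defs.v *)
From HB Require Import structures.
From mathcomp Require Import all_boot all_order all_algebra.
From mathcomp Require Import all_classical all_reals topology.

Set Implicit Arguments.
Unset Strict Implicit.
Unset Printing Implicit Defensive.

Import Order.TTheory GRing.Theory Num.Theory.
Local Open Scope classical_set_scope.
Local Open Scope ring_scope.

Record substitution (A : finType) := Substitution {
  subst_fun :> A -> seq A;
  subst_neq0 : forall a, subst_fun a != [::]
}.

Definition subst_word (A : finType) (phi : substitution A) (u : seq A) : seq A :=
  flatten (map phi u).

Definition subst_iter (A : finType) (phi : substitution A) (k : nat) (a : A) :
    seq A :=
  iter k (subst_word phi) [:: a].

Definition admitted (A : finType) (phi : substitution A) (u : seq A) : Prop :=
  exists (a : A) (k : nat), infix u (subst_iter phi k a).

Definition primitive (A : finType) (phi : substitution A) : Prop :=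
  exists2 p : nat, (0 < p)%N & forall a a' : A, a' \in subst_iter phi p a.

Definition fullshift (A : finType) : Type :=
  prod_topology (fun _ : int => discrete_topology A).

HB.instance Definition _ (A : finType) := Nbhs.on (fullshift A).
HB.instance Definition _ (A : finType) := Topological.on (fullshift A).

Definition shift (A : finType) (w : fullshift A) : fullshift A :=
  fun i => w (i + 1).

(* The power shift^k for k : int; see shift_pow_nat and shift_powK. *)
Definition shift_pow (A : finType) (k : int) (w : fullshift A) : fullshift A :=
  fun i => w (i + k).

Lemma shift_pow_nat (A : finType) (n : nat) (w : fullshift A) :
  shift_pow n%:Z w = iter n (@shift A) w.
Proof.
elim: n => [|n IHn] /=; apply/funext => i; first by rewrite /shift_pow addr0.
by rewrite -IHn /shift_pow /shift -addrA intS.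
Qed.

Lemma shift_powK (A : finType) (k : int) :
  cancel (@shift_pow A k) (@shift_pow A (- k)).
Proof. by move=> w; apply/funext => i; rewrite /shift_pow subrK. Qed.

Definition subword (A : finType) (w : fullshift A) (i : int) (n : nat) : seq A :=
  mkseq (fun j : nat => w (i + j%:Z)) n.

Definition subshift (A : finType) (phi : substitution A) : set (fullshift A) :=
  [set w | forall (i : int) (n : nat), admitted phi (subword w i n)].

Lemma subshift_shift (A : finType) (phi : substitution A) (w : fullshift A) :
  subshift phi w -> subshift phi (shift w).
Proof.
move=> Xw i n; have := Xw (i + 1) n; congr admitted.
by apply: eq_mkseq => j; rewrite /shift addrAC.
Qed.

Lemma closed_subshift (A : finType) (phi : substitution A) : closed (subshift phi).
Proof.
move=> w clw i n.
have ev (j : int) : \forall v \near w, v j = w j.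
  have := @proj_continuous int (fun=> discrete_topology A) j w [set w j].
  by apply; rewrite /nbhs /=; apply/principal_filterP.
have : \forall v \near w, subword v i n = subword w i n.
  elim: n {clw} => [|n IH]; first by near=> v.
  near=> v; rewrite /subword !mkseqS; congr rcons; last by near: v; exact: ev.
  by near: v.
by move/clw => -[v [Xv <-]]; apply: Xv.
Unshelve. all: by end_near.
Qed.

(* The shift as a self-map of the space [subshift phi], which as a type carries
   the topology induced by [fullshift A]. *)
Definition sigma (A : finType) (phi : substitution A) (x : subshift phi) :
    subshift phi :=
  SigSub (mem_set (subshift_shift (set_valP x))).

Definition orbit (A : finType) (w : fullshift A) : set (fullshift A) :=
  [set shift_pow k w | k in [set: int]].

(* By closed_subshift, the closure in [fullshift A] of a subset of
   [subshift phi] is also its closure in [subshift phi]. *)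
Definition minimal_component (A : finType) (phi : substitution A)
    (L : set (fullshift A)) : Prop :=
  [/\ L !=set0, L `<=` subshift phi & forall w, L w -> L = closure (orbit w)].

Definition minimal_substitution (A : finType) (phi : substitution A) : Prop :=
  minimal_component phi (subshift phi).

Definition topologically_conjugate (T U : topologicalType)
    (s : T -> T) (t : U -> U) : Prop :=
  exists (f : T -> U) (g : U -> T),
    [/\ cancel f g, cancel g f, continuous f, continuous g &
        forall x, f (s x) = t (f x)].

(* Main.v *)
Require Import Defs.
From mathcomp Require Import all_boot all_algebra all_classical topology.
From mathcomp Require Import zify.
Local Open Scope classical_set_scope.

Set Implicit Arguments.
Unset Strict Implicit.
Unset Printing Implicit Defensive.

(** Write [X] for the subshift of [phi] and [L] for its language. Minimality
    makes [X] uniformly recurrent: every word of [L] occurs in all long enough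
    words of [L] ([uniformly_recurrent]).

    The construction starts from a substitution [f] that maps [L] into [L],
    and a letter [a] of [X] whose images under the powers of [f] have unbounded
    length ([unbounded_language_substitution]). If some letter of [X]
    is of this kind for [phi], then [f] is [phi]. Otherwise the long words
    admitted by [phi] grow only near their ends, and following one of the ends
    exhibits a non-empty word [u] all of whose powers are in [L]
    ([bounded_powers]); then [f] maps every letter to [u ++ u].

    Let [F] be a high power of [f], so that [F [:: a] = x ++ a :: y]. Cut the
    points of [X] before each [a] into return words [r], of which there are
    finitely many. The conjugate map sending [v] to [x^-1 F(v) x] takes words that
    start with [a] and are followed by [a] to words of the same kind, hence acts
    on concatenations of return words; and as [F] is a high power, the image
    of each return word contains all return words and splits into at least as
    many of them as the original has letters. The alphabet of [theta] is
    the set of pairs of a return word and a position in it. The return words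
    that make up the image of [r] are dealt out to the positions of [r], at least
    one to each. Thus every letter is mapped to a word containing all the
    positions of some return word, and [theta^2] of every letter contains
    every letter ([tower_primitive]).

    Finally, a point of [X] determines the return word around each of its
    positions, which depends only on a finite window, and the letter at a
    position can be read off from the return word there. These two sliding block
    codes are inverse bijections between [X] and the subshift of [theta]
    ([tower_conjugate]), because the words admitted by [theta] are the subwords
    of the codes of words of [L] ([tower_admitted_code],
    [code_tower_admitted]). *)

(** * Finiteness and pigeonhole principles *)

Lemma bounded_words (A : finType) (n : nat) :
  exists s : seq (seq A), forall v, (v \in s) = (size v <= n)%N.
Proof.
exists (flatten [seq [seq val t | t <- enum {: k.-tuple A}] | k <- iota 0 n.+1]).
move=> v; apply/flattenP/idP => [[_ /mapP[k + ->]]|vn].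
  rewrite mem_iota ltnS => /= kn /mapP[t _ ->].
  by rewrite size_tuple.
exists [seq val t | t <- enum {: (size v).-tuple A}].
  by apply/mapP; exists (size v); rewrite // mem_iota.
by apply/mapP; exists (in_tuple v); rewrite // mem_enum.
Qed.

Lemma pigeonhole_seq (T : eqType) (s : seq T) (h : nat -> T) :
  (forall i, h i \in s) -> exists i j, (i < j)%N /\ h i = h j.
Proof.
move=> hs; apply: contrapT => nex.
have : uniq (mkseq h (size s).+1).
  apply/(uniqP (h 0%N)) => i j; rewrite !inE !size_mkseq => iK jK.
  rewrite !nth_mkseq// => hij; case: (ltngtP i j) => // ij; case: nex.
    by exists i, j.
  by exists j, i.
move/uniq_leq_size => /(_ s); rewrite size_mkseq ltnn => H.
by apply: notF; apply: H => _ /mapP[k _ ->].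
Qed.

(** Were every [t] to fail at some stage, all would fail at the largest of these
    finitely many stages. *)
Lemma finite_uniform (T : finType) (Q : T -> nat -> Prop) :
    (forall t n, Q t n.+1 -> Q t n) -> (forall n, exists t, Q t n) ->
  exists t, forall n, Q t n.
Proof.
move=> Qanti Qex; apply: contrapT => /forallNP/= nQ.
have {}nQ t : exists n, ~ Q t n by apply/existsNP; exact: nQ.
have [N NP] := choice nQ.
have [t] := Qex (\max_t N t).
have : (N t <= \max_t N t)%N by exact: leq_bigmax.
move: (\max_t N t) => m /subnK <-; elim: (m - N t)%N => [|k IH].
  by rewrite add0n => /NP.
by rewrite addSn => /Qanti /IH.
Qed.

(** * Bi-infinite words from extendable finite words *)

Section Konig.
Variables (A : finType) (P : seq A -> Prop).
Hypothesis P_infix : forall u v, infix u v -> P v -> P u.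

Definition extendable (v : seq A) :=
  forall n, exists x y, [/\ (n <= size x)%N, (n <= size y)%N & P (x ++ v ++ y)].

Lemma extendable_step v : extendable v ->
  exists bc : A * A, extendable (bc.1 :: rcons v bc.2).
Proof.
move=> ev; have [|n|bc bcP] := @finite_uniform (A * A)%type (fun bc n =>
    exists x y, [/\ (n <= size x)%N, (n <= size y)%N &
                    P (x ++ (bc.1 :: rcons v bc.2) ++ y)]).
- by move=> t n [x [y [nx ny Pxy]]]; exists x, y; split=> //; apply: ltnW.
- have [x [y []]] := ev n.+1.
  case: (lastP x) => [|{}x b]; first by rewrite ltn0.
  case: y => [|c y] /=; first by rewrite ltn0.
  rewrite size_rcons !ltnS => nx ny Pv.
  exists (b, c), x, y; split => //.
  by move: Pv; rewrite -cats1 -catA /= -cats1 -catA.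
by exists bc.
Qed.

(** Compactness of the full shift, by hand: prolonging an extendable word by a
    suitable letter on each side keeps it extendable, so this can be repeated
    for ever, and the limit contains only subwords of the words met. *)
Lemma extendable_limit v : extendable v ->
  exists w : fullshift A,
    (forall i n, P (subword w i n)) /\ subword w 0 (size v) = v.
Proof.
move=> ev.
have [[a0 _] _] := extendable_step ev.
have step u : exists bc : A * A, extendable u -> extendable (bc.1 :: rcons u bc.2).
  have [/extendable_step[bc bcP]|nu] := pselect (extendable u); first by exists bc.
  by exists (a0, a0).
have [st stP] := choice step.
pose V n := iter n (fun u => (st u).1 :: rcons u (st u).2) v.
have VS n : V n.+1 = (st (V n)).1 :: rcons (V n) (st (V n)).2 by [].
have Ve n : extendable (V n) by elim: n => // n; rewrite VS; exact: stP.
have PV n : P (V n).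
  have [x [y [_ _]]] := Ve n 0%N; apply: P_infix.
  exact: infix_infix.
have sV n : size (V n) = (size v + n.*2)%N.
  by elim: n => [|n IH]; rewrite ?addn0// VS /= size_rcons IH doubleS !addnS.
(* Position [i] of the limit is the letter [n + i] of [V n], for all large [n]. *)
pose w : fullshift A := fun i : int => nth a0 (V `|i|%N.+1) `|(`|i|%N.+1%:Z + i)%R|%N.
have wE (i : int) n : (`|i| < n)%N -> w i = nth a0 (V n) `|(n%:Z + i)%R|%N.
  move=> iltn; have -> : n = (n - `|i|.+1 + `|i|.+1)%N by rewrite subnK.
  elim: (n - `|i|.+1)%N => [//|k IH]; rewrite addSn VS.
  have -> : `|((k + `|i|.+1).+1%:Z + i)%R|%N = `|((k + `|i|.+1)%:Z + i)%R|%N.+1 by lia.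
  rewrite /= nth_rcons sV ifT; first exact: IH.
  by lia.
have subE i n N : (`|i| + n < N)%N ->
    subword w i n = take n (drop `|(N%:Z + i)%R|%N (V N)).
  move=> H; have sE : size (take n (drop `|(N%:Z + i)%R|%N (V N))) = n.
    by rewrite size_takel// size_drop sV; lia.
  apply: (@eq_from_nth _ a0) => [|k]; rewrite size_mkseq ?sE// => kn.
  rewrite nth_mkseq// nth_take// nth_drop (wE _ N); first by congr nth; lia.
  by lia.
exists w; split => [i n|].
  rewrite (subE i n (`|i| + n).+1)//; apply: P_infix (PV (`|i| + n).+1).
  exact: infix_trans (infix_take _ _) (infix_drop _ _).
have VK k : take (size v) (drop k (V k)) = v.
  elim: k => [|k IH]; first by rewrite drop0 take_size.
  rewrite VS /= drop_rcons ?sV; last by lia.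
  by rewrite -cats1 takel_cat ?IH// size_drop sV; lia.
rewrite (subE _ _ (size v).+1)// -[RHS](VK (size v).+1).
by congr (take _ (drop _ _)); lia.
Qed.

(** Infinitely many of the words have the same letter in the middle, and this
    letter is extendable. *)
Lemma long_words_limit : (forall n, exists2 v, (n <= size v)%N & P v) ->
  exists w : fullshift A, forall i n, P (subword w i n).
Proof.
move=> long; have [|n|b bP] := @finite_uniform A (fun b n =>
    exists x y, [/\ (n <= size x)%N, (n <= size y)%N & P (x ++ [:: b] ++ y)]).
- by move=> t n [x [y [nx ny Pxy]]]; exists x, y; split=> //; apply: ltnW.
- have [v vn Pv] := long (n + n).+1.
  have : (n <= size (take n v))%N by rewrite size_takel//; lia.
  have : (n < size (drop n v))%N by rewrite size_drop; lia.
  rewrite -(cat_take_drop n v) in Pv.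
  case: (drop n v) Pv => // b y Pv; rewrite ltnS => ny nx.
  by exists b, (take n v), y.
by have [w [wP _]] := extendable_limit bP; exists w.
Qed.

End Konig.

(** * Substitutions as word morphisms *)

Section SubstitutionMorphism.
Variables (A : finType) (phi : substitution A).
Implicit Types u v : seq A.

Lemma subst_word_cat u v :
  subst_word phi (u ++ v) = subst_word phi u ++ subst_word phi v.
Proof. by rewrite /subst_word map_cat flatten_cat. Qed.

Lemma subst_word1 a : subst_word phi [:: a] = phi a.
Proof. by rewrite /subst_word /= cats0. Qed.

Lemma leq_size_subst_word u : (size u <= size (subst_word phi u))%N.
Proof.
elim: u => //= a u IH; rewrite -cat1s subst_word_cat size_cat subst_word1.
by have := subst_neq0 phi a; case: (phi a) => //= b s _; lia.
Qed.

Lemma iter_subst_word_cat k u v : iter k (subst_word phi) (u ++ v) =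
  iter k (subst_word phi) u ++ iter k (subst_word phi) v.
Proof. by elim: k => //= k ->; rewrite subst_word_cat. Qed.

Lemma iter_subst_word0 k : iter k (subst_word phi) [::] = [::].
Proof. by elim: k => //= k ->. Qed.

Lemma leq_size_iter_subst_word k u :
  (size u <= size (iter k (subst_word phi) u))%N.
Proof.
by elim: k => //= k IH; apply: leq_trans (leq_size_subst_word _).
Qed.

Lemma iter_subst_word_infix k u v : infix u v ->
  infix (iter k (subst_word phi) u) (iter k (subst_word phi) v).
Proof.
move=> /infixP[x [y ->]]; rewrite !iter_subst_word_cat; exact: infix_infix.
Qed.

Lemma admitted_infix u v : infix u v -> admitted phi v -> admitted phi u.
Proof. by move=> uv [a [k vk]]; exists a, k; exact: infix_trans vk. Qed.

Lemma admitted_iter k u :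
  admitted phi u -> admitted phi (iter k (subst_word phi) u).
Proof.
move=> [a [n un]]; exists a, (k + n)%N.
by rewrite /subst_iter iterD; exact: iter_subst_word_infix.
Qed.

End SubstitutionMorphism.

(** * The language of a minimal subshift *)

Section Subwords.
Variable A : finType.
Implicit Types (w : fullshift A) (u v : seq A).

Lemma size_subword w i n : size (subword w i n) = n.
Proof. by rewrite size_mkseq. Qed.

Lemma subword_cat w i m n :
  subword w i (m + n) = subword w i m ++ subword w (i + m%:Z)%R n.
Proof.
rewrite /subword /mkseq iotaD map_cat add0n -[m in iota m n]addn0 iotaDl.
rewrite -map_comp; congr cat.
by apply: eq_map => k /=; congr w; lia.
Qed.

Lemma infix_subwordP w i n u : infix u (subword w i n) ->
  exists2 k, (k + size u <= n)%N & subword w (i + k%:Z)%R (size u) = u.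
Proof.
move=> /infixP[x [y e]]; have := congr1 size e.
rewrite size_subword !size_cat => en.
exists (size x); first by rewrite en addnA leq_addr.
move: e; rewrite en subword_cat subword_cat.
move/eqP; rewrite eqseq_cat ?size_subword// => /andP[_].
by rewrite eqseq_cat ?size_subword// => /andP[/eqP].
Qed.

Lemma subword_infix w i j m n : (i <= j)%R -> (j + m%:Z <= i + n%:Z)%R ->
  infix (subword w j m) (subword w i n).
Proof.
move=> ij jm; have -> : n = (`|(j - i)%R|%N + (m + `|(i + n%:Z - (j + m%:Z))%R|%N))%N.
  by lia.
rewrite !subword_cat; have -> : (i + `|(j - i)%R|%N%:Z)%R = j by lia.
exact: infix_infix.
Qed.

Definition language (X : set (fullshift A)) u :=
  exists2 w, X w & exists i, subword w i (size u) = u.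

Lemma language_subword (X : set (fullshift A)) w i n :
  X w -> language X (subword w i n).
Proof. by move=> Xw; exists w => //; exists i; rewrite size_subword. Qed.

Lemma language_infix (X : set (fullshift A)) u v :
  infix u v -> language X v -> language X u.
Proof.
move=> uv [w Xw [i iv]]; rewrite -iv in uv.
by have [k _ ku] := infix_subwordP uv; exists w => //; exists (i + k%:Z)%R.
Qed.

Lemma language_extendable (X : set (fullshift A)) u :
  language X u -> extendable (language X) u.
Proof.
move=> [w Xw [i iu]] n.
exists (subword w (i - n%:Z)%R n), (subword w (i + (size u)%:Z)%R n).
rewrite !size_subword; split => //.
suff -> : subword w (i - n%:Z)%R n ++ u ++ subword w (i + (size u)%:Z)%R n =
  subword w (i - n%:Z)%R (n + (size u + n)) by exact: language_subword.
by rewrite !subword_cat GRing.subrK iu.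
Qed.

End Subwords.

Section MinimalLanguage.
Variables (A : finType) (phi : substitution A).
Local Notation L := (language (subshift phi)).

Lemma language_admitted u : L u -> admitted phi u.
Proof. by move=> [w Xw [i <-]]. Qed.

Lemma extendable_language u : extendable (admitted phi) u -> L u.
Proof.
move=> /(extendable_limit (@admitted_infix _ _))[w [wX wu]].
by exists w => //; exists 0%R.
Qed.

(** Images of the extensions of [u] extend the image of [u]; they are only known
    to be admitted, which suffices by [extendable_language]. *)
Lemma language_subst u : L u -> L (subst_word phi u).
Proof.
move=> /language_extendable Lu; apply: extendable_language => n.
have [x [y [nx ny /language_admitted/(admitted_iter 1) /=]]] := Lu n.
rewrite !subst_word_cat => ad.
exists (subst_word phi x), (subst_word phi y); split=> //.
  exact: leq_trans (leq_size_subst_word _ _).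
exact: leq_trans (leq_size_subst_word _ _).
Qed.

Lemma subshift_language w : subshift phi w <-> forall i n, L (subword w i n).
Proof.
split=> [Xw i n|Lw i n]; first exact: language_subword.
exact: language_admitted.
Qed.

Lemma near_subword (w : fullshift A) (i : int) (n : nat) :
  \forall v \near w, subword v i n = subword w i n.
Proof.
have ev (j : int) : \forall v \near w, v j = w j.
  have := @proj_continuous int (fun=> discrete_topology A) j w [set w j].
  by apply; rewrite /nbhs /=; apply/principal_filterP.
elim: n => [|n IH]; first by near=> v.
near=> v; rewrite /subword !mkseqS; congr rcons; last by near: v; exact: ev.
by near: v.
Unshelve. all: by end_near.
Qed.

(** Long words of the language avoiding [u] would have a limit avoiding [u],
    whose orbit could not approach the points of the subshift where [u]
    occurs. *)
Lemma uniformly_recurrent u : minimal_substitution phi -> L u ->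
  exists M, forall v, L v -> (M <= size v)%N -> infix u v.
Proof.
move=> [_ _ minX] [w' Xw' [i iu]]; apply: contrapT => /forallNP nM.
pose P v := L v /\ ~~ infix u v.
have Pinf v1 v2 : infix v1 v2 -> P v2 -> P v1.
  move=> v12 [Lv2 uv2]; split; first exact: language_infix Lv2.
  by apply: contra uv2 => uv1; exact: infix_trans v12.
have [n|w wP] := long_words_limit Pinf.
  apply: contrapT => nP; apply: (nM n) => v Lv nv; apply: contrapT => uv.
  by apply: nP; exists v => //; split=> //; apply/negP.
have Xw : subshift phi w by apply/subshift_language => j n; exact: (wP j n).1.
have : closure (Defs.orbit w) w' by rewrite -(minX w Xw).
move=> /(_ _ (near_subword w' i (size u)))[_ [[k _ <-] /=]].
rewrite iu => ku; have [_ /negP] := wP (i + k)%R (size u); apply.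
rewrite -{1}ku.
have -> : subword (shift_pow k w) i (size u) = subword w (i + k)%R (size u).
  by apply: eq_mkseq => j; rewrite /shift_pow; congr w; lia.
exact: infix_refl.
Qed.

End MinimalLanguage.

(** * Letters of unbounded growth *)

Definition unbounded (A : finType) (phi : substitution A) (a : A) :=
  forall n, exists k, (n <= size (subst_iter phi k a))%N.

Definition power (A : Type) (u : seq A) (n : nat) := flatten (nseq n u).

Section Power.
Variables (A : Type) (u : seq A).

Lemma powerD m n : power u (m + n) = power u m ++ power u n.
Proof. by rewrite /power nseqD flatten_cat. Qed.

Lemma powerSr n : power u n.+1 = power u n ++ u.
Proof. by rewrite -addn1 powerD /power /= cats0. Qed.

Lemma size_power n : size (power u n) = (n * size u)%N.
Proof. by elim: n => //= n IH; rewrite /power /= size_cat -/(power _ _) IH. Qed.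

End Power.

Lemma prefix_of_cat (T : Type) (x X s t : seq T) :
  x ++ s = X ++ t -> (size x <= size X)%N -> X = x ++ drop (size x) X.
Proof.
move=> e xX; rewrite -{1}(cat_take_drop (size x) X); congr cat.
by rewrite -(takel_cat t xX) -e take_size_cat.
Qed.

Lemma suffix_of_cat (T : Type) (y Y s t : seq T) :
  s ++ y = t ++ Y -> (size y <= size Y)%N -> Y = take (size Y - size y) Y ++ y.
Proof.
move=> e yY; rewrite -{1}(cat_take_drop (size Y - size y) Y); congr cat.
have := congr1 size e; rewrite !size_cat => se.
have -> : Y = drop (size t) (s ++ y) by rewrite e drop_size_cat.
rewrite drop_drop -[RHS](drop_size_cat y (erefl (size s))) e; congr drop.
by rewrite drop_size_cat//; lia.
Qed.

Section Growth.
Variables (A : finType) (phi : substitution A).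
Local Notation L := (language (subshift phi)).
Local Notation G k u := (iter k (subst_word phi) u).

Lemma size_iter_subst_word_mono k m u :
  (k <= m)%N -> (size (G k u) <= size (G m u))%N.
Proof. by move/subnK <-; rewrite iterD; exact: leq_size_iter_subst_word. Qed.

(** The iterates of a letter of bounded growth range over finitely many words,
    hence become periodic. A common multiple [N] of the periods that exceeds the
    preperiods gives a power of [phi] fixing its own images of such letters. *)
Lemma bounded_eventually_idempotent :
    (forall b, L [:: b] -> ~ unbounded phi b) ->
  exists2 N, (0 < N)%N & forall d u, (0 < d)%N -> (forall b, b \in u -> L [:: b]) ->
    G (d * N) u = G N u.
Proof.
move=> bd.
have per b : exists N, (0 < N)%N /\
    forall m, (0 < m)%N -> L [:: b] -> G (m * N + m * N) [:: b] = G (m * N) [:: b].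
  have [Lb|nLb] := pselect (L [:: b]); last by exists 1%N.
  have /existsNP[n /forallNP bn] := bd b Lb.
  have [s sP] := bounded_words A n.
  have [|i [j [ij eij]]] := @pigeonhole_seq _ s (fun k => G k [:: b]).
    by move=> k; rewrite sP ltnW// ltnNge; apply/negP; exact: bn.
  have step k : (i <= k)%N -> G (k + (j - i)) [:: b] = G k [:: b].
    move=> ik; have -> : (k + (j - i) = (k - i) + j)%N by lia.
    by rewrite iterD -eij -iterD subnK.
  have steps k m : (i <= k)%N -> G (k + m * (j - i)) [:: b] = G k [:: b].
    move=> ik; elim: m => [|m IH]; first by rewrite mul0n addn0.
    by rewrite mulSn addnCA addnC step//; lia.
  exists (i.+1 * (j - i))%N; split=> [|m m0 _]; first by rewrite muln_gt0 subn_gt0.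
  by rewrite {2}mulnA steps//; nia.
have [N NP] := choice per.
have idem b : L [:: b] ->
    G (\prod_b N b + \prod_b N b) [:: b] = G (\prod_b N b) [:: b].
  move=> Lb; rewrite (bigD1 b)//= mulnC; apply: (NP b).2 => //.
  by apply: prodn_gt0 => c; exact: (NP c).1.
exists (\prod_b N b); first by apply: prodn_gt0 => b; exact: (NP b).1.
move: (\prod_b N b) idem => {NP}N idem.
move=> d u d0 Lu; have e : G (N + N) u = G N u.
  elim: u Lu => [|b u IH] Lu; first by rewrite !iter_subst_word0.
  rewrite -cat1s !iter_subst_word_cat idem ?IH//.
    by move=> c cu; apply: Lu; rewrite inE cu orbT.
  by apply: Lu; rewrite mem_head.
case: d d0 => // d _; elim: d => [|d IH]; first by rewrite mul1n.
by rewrite mulSn iterD IH -iterD.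
Qed.

(** A letter seen arbitrarily deep inside admitted words has a limit point of
    these words around it, and there are finitely many letters. *)
Lemma inner_letters : exists M, forall x b y, (M <= size x)%N ->
  (M <= size y)%N -> admitted phi (x ++ b :: y) -> L [:: b].
Proof.
pose Q b n := ~ L [:: b] /\ exists x y,
  [/\ (n <= size x)%N, (n <= size y)%N & admitted phi (x ++ [:: b] ++ y)].
apply: contrapT => /forallNP nM; have [|n|b bQ] := @finite_uniform A Q.
- move=> b n [nLb [x [y [nx ny ad]]]]; split=> //.
  by exists x, y; split=> //; exact: ltnW.
- apply: contrapT => /forallNP nQ; apply: (nM n) => x b y nx ny ad.
  by apply: contrapT => nLb; apply: (nQ b); split=> //; exists x, y.
by apply: (bQ 0%N).1; apply: extendable_language => n; exact: (bQ n).2.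
Qed.

(** The words [iter k phi c], for a letter [c] of unbounded growth, consist of
    letters of the subshift except near their two ends. When two of them, [q]
    steps apart, have the same ends [x] and [y], then [phi^q] maps [x] to
    [x ++ s] and [y] to [t ++ y]. Iterating, [x] grows to [x ++ s] followed by ever
    higher powers of [phi^q s], since [phi^q] is idempotent on letters of the
    subshift; likewise [y] grows to the left. *)
Lemma bounded_powers : subshift phi !=set0 ->
    (forall b, L [:: b] -> ~ unbounded phi b) ->
  exists2 u : seq A, u != [::] & forall n, L (power u n).
Proof.
move=> [w Xw] /bounded_eventually_idempotent[N N0 idem].
have [|n|c cP] := @finite_uniform A (fun c n => exists k, (n <= size (G k [:: c]))%N).
- by move=> c n [k /ltnW]; exists k.
- have [c [k /size_infix]] := Xw 0%R n; rewrite size_subword => nk.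
  by exists c, k.
have [M innerL] := inner_letters.
have [k0 k0P] := cP (M + M)%N.
pose h i := G (k0 + i * N) [:: c].
have hM i : (M + M <= size (h i))%N.
  by apply: leq_trans k0P _; apply: size_iter_subst_word_mono; exact: leq_addr.
have [s sP] := bounded_words A M.
pose ends i := (take M (h i), drop (size (h i) - M) (h i)).
have [|i [j [ij [xE yE]]]] :=
    @pigeonhole_seq _ [seq (p, q) | p <- s, q <- s] ends.
  move=> i; apply/allpairsP; exists (ends i); split=> //=; rewrite sP.
    by rewrite size_take_min geq_minl.
  by rewrite size_drop subKn//; apply: leq_trans (hM i); exact: leq_addr.
(* The images [h i] are at least twice as long as their ends, which therefore do
   not overlap. *)
pose mid i := take (size (h i) - M - M) (drop M (h i)).
have hE k : h k = take M (h k) ++ mid k ++ drop (size (h k) - M) (h k).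
  rewrite -{1}(cat_take_drop M (h k)); congr cat.
  rewrite /mid -{1}(cat_take_drop (size (h k) - M - M) (drop M (h k))).
  by congr cat; rewrite drop_drop; congr drop; have := hM k; lia.
have hadm k : admitted phi (h k) by exists c, (k0 + k * N)%N; exact: infix_refl.
have midL k b : b \in mid k -> L [:: b].
  move: (hadm k); rewrite hE => + /splitPr bm; case: bm => p1 p2.
  rewrite -catA cat_cons catA => ad.
  apply: innerL ad; rewrite size_cat.
    by rewrite size_takel; [|have := hM k]; lia.
  by rewrite size_drop; have := hM k; lia.
have hEj := hE j; rewrite -xE -yE in hEj.
have hEi := hE i.
have sx : size (take M (h i)) = M by rewrite size_takel//; have := hM i; lia.
have sy : size (drop (size (h i) - M) (h i)) = M.
  by rewrite size_drop; have := hM i; lia.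
move: (take M (h i)) (drop _ (h i)) hEi hEj sx sy => x y hEi hEj sx sy.
pose d := (j - i)%N; pose Phi u := G (d * N) u.
have d0 : (0 < d)%N by rewrite subn_gt0.
have Phih : Phi (h i) = h j.
  by rewrite /Phi /h -iterD; congr (G _ _); rewrite /d; nia.
have Phicat u v : Phi (u ++ v) = Phi u ++ Phi v by exact: iter_subst_word_cat.
have Phisz u : (size u <= size (Phi u))%N by exact: leq_size_iter_subst_word.
have : x ++ mid j ++ y = Phi x ++ Phi (mid i) ++ Phi y.
  by rewrite -hEj -Phih hEi !Phicat.
move=> e; have xs := prefix_of_cat e (Phisz x).
have ty : Phi y = take (size (Phi y) - size y) (Phi y) ++ y.
  by move: e; rewrite !catA => /suffix_of_cat; apply.
move: (drop _ (Phi x)) (take _ (Phi y)) xs ty => s' t xs ty.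
have midE : mid j = s' ++ Phi (mid i) ++ t.
  move: e; rewrite xs ty -!catA => /(congr1 (drop (size x))).
  rewrite !drop_size_cat// !catA => /(congr1 rev); rewrite !(rev_cat _ y).
  by move=> /(congr1 (drop (size (rev y)))); rewrite !drop_size_cat// => /(can_inj revK).
have idemPhi u : (forall b, b \in u -> L [:: b]) -> Phi (Phi u) = Phi u.
  by move=> Lu; rewrite /Phi -iterD -mulnDl !idem// addn_gt0 d0.
have s'L b : b \in s' -> L [:: b].
  by move=> bs; apply: (midL j); rewrite midE mem_cat bs.
have tL b : b \in t -> L [:: b].
  by move=> bs; apply: (midL j); rewrite midE !mem_cat bs !orbT.
have iterPhi n u : G (n * (d * N)) u = iter n Phi u.
  by elim: n => //= n <-; rewrite mulSn iterD.
have adx : admitted phi x.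
  by apply: admitted_infix (hadm i); rewrite hEi; exact: prefix_infix.
have ady : admitted phi y.
  by apply: admitted_infix (hadm i); rewrite hEi catA; exact: suffix_infix.
have Phipow u n : Phi u = u -> Phi (power u n) = power u n.
  move=> eu; elim: n => [|n IH]; first exact: iter_subst_word0.
  by rewrite powerSr Phicat IH eu.
have powers u : (forall n, admitted phi (power u n)) -> u != [::] ->
    exists2 u : seq A, u != [::] & forall n, L (power u n).
  move=> pu u0; exists u => // n; apply: extendable_language => m.
  exists (power u m), (power u m); rewrite -!powerD; split=> //;
  by rewrite size_power leq_pmulr// lt0n size_eq0.
have Phi0 u : u != [::] -> Phi u != [::].
  by rewrite -!size_eq0 -!lt0n => /leq_trans; apply.
have [s0|s0] := eqVneq s' [::]; last first.
  apply: (powers (Phi s')); last exact: Phi0.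
  move=> n; apply: admitted_infix (admitted_iter (n.+1 * (d * N)) adx).
  suff -> : G (n.+1 * (d * N)) x = (x ++ s') ++ power (Phi s') n by exact: suffix_infix.
  rewrite iterPhi; elim: n => [|n IH]; first by rewrite /= xs cats0.
  rewrite iterS IH !Phicat Phipow ?idemPhi// xs -!catA; congr (_ ++ (_ ++ _)).
have [t0|t0] := eqVneq t [::]; last first.
  apply: (powers (Phi t)); last exact: Phi0.
  move=> n; apply: admitted_infix (admitted_iter (n.+1 * (d * N)) ady).
  suff -> : G (n.+1 * (d * N)) y = power (Phi t) n ++ t ++ y by exact: prefix_infix.
  rewrite iterPhi; elim: n => [|n IH]; first by rewrite /= ty.
  by rewrite iterS IH !Phicat Phipow ?idemPhi// ty powerSr -!catA.
(* Without growth at either end, the images of [c] stay bounded. *)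
have fix_h n : G (n.+1 * (d * N)) (h i) = x ++ Phi (mid i) ++ y.
  rewrite iterPhi; elim: n => [|n IH].
    by rewrite /= hEi !Phicat xs ty s0 t0 cats0.
  rewrite iterS IH !Phicat xs ty s0 t0 cats0 idemPhi//; exact: midL.
have [k kP] := cP (size (x ++ Phi (mid i) ++ y)).+1.
have kle : (k <= k.+1 * (d * N) + (k0 + i * N))%N by nia.
have := leq_trans kP (size_iter_subst_word_mono [:: c] kle).
by rewrite iterD fix_h ltnn.
Qed.

(** When no letter of the subshift grows under [phi], the words of
    [bounded_powers] allow replacing [phi] by the substitution with constant
    value [u ++ u], which maps all words to powers of [u]. The doubling makes
    lengths grow even when [u] is a single letter. *)
Lemma unbounded_language_substitution : subshift phi !=set0 ->
  exists (f : substitution A) (a : A),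
    [/\ forall u, L u -> L (subst_word f u), L [:: a] & unbounded f a].
Proof.
move=> X0; have [[a [La ua]]|nu] := pselect (exists a, L [:: a] /\ unbounded phi a).
  by exists phi, a; split=> // u; exact: language_subst.
have [u u0 uP] : exists2 u : seq A, u != [::] & forall n, L (power u n).
  by apply: bounded_powers => // b Lb ub; apply: nu; exists b.
case: u u0 uP => // a u _ uP.
have [f fE] : exists f : substitution A, forall b, f b = (a :: u) ++ (a :: u).
  have uu0 (b : A) : (fun=> (a :: u) ++ (a :: u)) b != [::] by [].
  by exists (Substitution uu0).
have fpow v : subst_word f v = power (a :: u) (size v).*2.
  elim: v => //= b v IH; rewrite -cat1s subst_word_cat IH doubleS.
  by rewrite subst_word1 fE /power /= -!catA.
exists f, a; split.
- by move=> v _; rewrite fpow; exact: uP.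
- apply: language_infix (uP 1%N); rewrite /power /= cats0.
  exact: (prefix_infix [:: a]).
- move=> n; exists n; suff : (n < size (subst_iter f n a))%N by exact: ltnW.
  by rewrite /subst_iter; elim: n => //= n IH; rewrite fpow size_power /=; nia.
Qed.

End Growth.

(** * Sliding block codes *)

Lemma local_continuous (A B : finType) (phi : substitution A)
    (theta : substitution B) (f : subshift phi -> subshift theta) :
    (forall x j, exists i n, forall x',
      subword (set_val x') i n = subword (set_val x) i n ->
      set_val (f x') j = set_val (f x) j) ->
  continuous f.
Proof.
move=> loc; apply: continuous_comp_initial => x; apply/cvg_sup.
  exact/fmap_filter/nbhs_filter.
move=> j U [_ [[W oW <-] /= Wx WU]]; have [i [n inP]] := loc x j.
have := @initial_continuous _ _ (set_val : subshift phi -> fullshift A) x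
  _ (near_subword (set_val x) i n).
apply: (@filterS _ _ (nbhs_filter x)) => x' /= /inP e; apply: WU => /=.
rewrite -[X in W X]/(set_val (f x') j) e.
exact: Wx.
Qed.

(** * Cutting words at a letter *)

Section Cut.
Variables (A : eqType) (a : A).
Implicit Types (u v r : seq A).

(** The return words to [a] in a language [L] are the words [r] of this shape
    with [L (rcons r a)]. *)
Definition return_shape r := if r is b :: t then (b == a) && (a \notin t) else false.

Fixpoint cut v : seq (seq A) :=
  if v is b :: v' then
    if cut v' is r :: c then
      if head b r == a then [:: b] :: r :: c else (b :: r) :: c
    else [:: [:: b]]
  else [::].

Lemma cutK v : flatten (cut v) = v.
Proof.
by elim: v => //= b v; case: (cut v) => [|r c] /= <- //; case: ifP.
Qed.

Lemma cut_eq0 v : (cut v == [::]) = (v == [::]).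
Proof. by case: v => //= b v; case: (cut v) => // r c; case: ifP. Qed.

Lemma cut_neq0 v r : r \in cut v -> r != [::].
Proof.
elim: v => //= b v; case: (cut v) => [_|s c IH]; first by rewrite inE => /eqP ->.
by case: ifP => _; rewrite inE => /predU1P[->//|rc]; apply: IH; rewrite ?inE ?rc ?orbT.
Qed.

Lemma head_head_cut b v : head b (head [::] (cut v)) = head b v.
Proof.
rewrite -[in RHS](cutK v); case e: (cut v) => [//|r c] /=.
have : r != [::] by apply: (@cut_neq0 v); rewrite e mem_head.
by case: r e.
Qed.

Lemma cut_cat v1 v2 : head a v2 == a -> cut (v1 ++ v2) = cut v1 ++ cut v2.
Proof.
move=> v2a; elim: v1 => //= b v1 ->.
have := head_head_cut b v1; case e1 : (cut v1) => [|r c] //= _; last by case: ifP.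
have := head_head_cut b v2; case: (cut v2) (cut_eq0 v2) => [//|r c] /= + ->.
by case: v2 v2a => //= _ v2 /eqP -> _; rewrite eqxx.
Qed.

(** The first piece starts with the first letter of [v], hence need not start
    with [a]. *)
Lemma cut_shape v :
  all return_shape (behead (cut v)) /\ a \notin behead (head [::] (cut v)).
Proof.
elim: v => //= b v; have := head_head_cut b v.
case e: (cut v) => [//|r c] /= hr [cP rP]; have [ra|ra] := eqVneq (head b r) a.
  rewrite /= cP andbT; split=> //.
  have : r != [::] by apply: (@cut_neq0 v); rewrite e mem_head.
  by case: r ra rP {e hr} => //= b' r -> ->; rewrite eqxx.
split=> //=; have : r != [::] by apply: (@cut_neq0 v); rewrite e mem_head.
by case: r ra rP {e hr} => //= b' r ba ra _; rewrite inE negb_or eq_sym ba.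
Qed.

Lemma cut_return_shape v : head a v == a -> all return_shape (cut v).
Proof.
have [] := cut_shape v; have := head_head_cut a v.
case e: (cut v) => [//|r c] /= <- -> ra; rewrite andbT.
have : r != [::] by apply: (@cut_neq0 v); rewrite e mem_head.
by case: r ra {e} => //= b r -> _ ->.
Qed.

Lemma cut_return r : return_shape r -> cut r = [:: r].
Proof.
case: r => //= b t /andP[_]; elim: t b => //= c t IH b.
by rewrite inE negb_or eq_sym => /andP[ca /IH ->] /=; rewrite (negPf ca).
Qed.

Lemma head_flatten_return c : all return_shape c -> head a (flatten c) == a.
Proof. by case: c => //= -[|b t] c //= /andP[/andP[]]. Qed.

End Cut.

(** * The tower substitution over the return words *)

Section Tower.
Variables (A : finType) (a : A) (L : seq A -> Prop).
Hypothesis L_infix : forall u v, infix u v -> L v -> L u.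
Hypothesis L_recurrent : forall u, L u ->
  exists M, forall v, L v -> (M <= size v)%N -> infix u v.

Variable rs : seq (seq A).
Hypothesis rsP : forall r, r \in rs <-> return_shape a r /\ L (rcons r a).

Variables (F : seq A -> seq A) (x y : seq A).
Hypothesis F_cat : forall u v, F (u ++ v) = F u ++ F v.
Hypothesis F_L : forall u, L u -> L (F u).
Hypothesis Fa : F [:: a] = x ++ a :: y.

(** The conjugate [x^-1 F(v) x] of [F], for [v] that starts with [a] or is empty:
    as [F v ++ x] then starts with [x], see [FcE], only the prefix [x] is lost. *)
Definition Fc v := drop (size x) (F v ++ x).

Hypothesis Fc_all : forall r r', r \in rs -> r' \in rs -> r' \in cut a (Fc r).
Hypothesis Fc_long : forall r, r \in rs -> (size r <= size (cut a (Fc r)))%N.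
Hypothesis F_grow : forall r, r \in rs -> (size r < size (F r))%N.

(** A block is a concatenation of return words: the final [a] that can follow it
    in the language completes the last of them. *)
Definition block v := head a v == a /\ L (rcons v a).

Lemma F0 : F [::] = [::].
Proof.
apply: size0nil; have := congr1 size (F_cat [::] [::]).
by rewrite size_cat /=; lia.
Qed.

Lemma FcE v : head a v == a -> x ++ Fc v = F v ++ x.
Proof.
case: v => [|b t] /=; first by rewrite /Fc F0 /= drop_size cats0.
move=> /eqP ->; rewrite /Fc -cat1s F_cat Fa -!catA drop_size_cat//.
Qed.

Lemma Fc_cat u v : head a u == a -> head a v == a -> Fc (u ++ v) = Fc u ++ Fc v.
Proof.
move=> ua va; have uva : head a (u ++ v) == a by case: u ua.
have := FcE uva; rewrite F_cat -catA -FcE// catA -FcE// -catA.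
by move/(congr1 (drop (size x))); rewrite !drop_size_cat.
Qed.

Lemma head_Fc v : head a v == a -> head a (Fc v) == a.
Proof.
case: v => [|b t] /=; first by rewrite /Fc F0 drop_size.
by move=> /eqP ->; rewrite /Fc -cat1s F_cat Fa -!catA drop_size_cat//=.
Qed.

(** [F (rcons v a)] is [F v ++ x ++ a :: y], where [F v ++ x] is [x ++ Fc v]. *)
Lemma block_Fc v : block v -> block (Fc v).
Proof.
move=> [va Lv]; split; first exact: head_Fc.
apply: L_infix (F_L Lv); rewrite -!cats1 F_cat Fa catA -FcE// -catA.
by apply: infix_catl; rewrite -(cat1s a y) catA; exact: prefix_infix.
Qed.

Lemma size_Fc v : head a v == a -> size (Fc v) = size (F v).
Proof. by move=> /FcE /(congr1 size); rewrite !size_cat; lia. Qed.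

Lemma block_return r : r \in rs -> block r.
Proof. by move=> /rsP[]; case: r => //= b t /andP[ba _]; split. Qed.

Lemma block_cut v : block v -> {subset cut a v <= rs}.
Proof.
move=> [va Lv] r rv; apply/rsP; have /allP vr := cut_return_shape va.
split; first exact: vr.
apply: L_infix Lv; rewrite -(cutK a v).
have : all (return_shape a) (cut a v) by apply/allP.
case/splitPr: rv => c1 c2; rewrite all_cat /= => /and3P[_ _ c2P].
rewrite flatten_cat /= -!cats1 -!catA; apply: infix_catl.
have := head_flatten_return c2P; case: (flatten c2) => [_|b t /= /eqP ->].
  exact: infix_refl.
by apply/infixP; exists [::], (t ++ [:: a]); rewrite /= -catA.
Qed.

Lemma size_F_flatten c : {subset c <= rs} ->
  (size (flatten c) + size c <= size (F (flatten c)))%N.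
Proof.
elim: c => // r c IH rc /=; rewrite F_cat !size_cat.
rewrite addnS -addnA -addSn leq_add//; first by apply: F_grow; rewrite rc// mem_head.
by apply: IH => s sc; apply: rc; rewrite inE sc orbT.
Qed.

Lemma size_Fc_block v : block v -> v != [::] -> (size v < size (Fc v))%N.
Proof.
move=> vb v0; rewrite size_Fc ?(proj1 vb)//.
have := size_F_flatten (block_cut vb); rewrite cutK; apply: leq_trans.
by rewrite -addn1 leq_add2l lt0n size_eq0 cut_eq0.
Qed.

Lemma block_iter_Fc k v : block v -> block (iter k Fc v).
Proof. by move=> vb; elim: k => //= k; exact: block_Fc. Qed.

Lemma size_iter_Fc k v : block v -> v != [::] -> (k < size (iter k Fc v))%N.
Proof.
move=> vb v0; elim: k => [|k IH] /=; first by rewrite lt0n size_eq0.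
apply: leq_ltn_trans (IH) _; apply: size_Fc_block; first exact: block_iter_Fc.
by case: (iter k Fc v) IH.
Qed.

Definition floors (r : seq A) : seq (seq A * seq A) :=
  [seq (take i r, drop i r) | i <- iota 0 (size r)].

Lemma floorsP r p s : ((p, s) \in floors r) = (p ++ s == r) && (s != [::]).
Proof.
apply/mapP/andP => [[i + [-> ->]]|[/eqP <- s0]].
  rewrite mem_iota /= add0n => ir; rewrite cat_take_drop eqxx; split=> //.
  by rewrite -size_eq0 size_drop subn_eq0 -ltnNge.
exists (size p); last by rewrite take_size_cat// drop_size_cat.
by rewrite mem_iota size_cat; case: s s0 => //= b s _; lia.
Qed.

(** A letter is a return word with a marked position, encoded by the parts of the
    word before that position and from it on; the second part is non-empty, as
    in [floors]. *)
Definition tower : finType := seq_sub (flatten (map floors rs)).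

Implicit Type z : tower.

Definition tower_word z := (val z).1 ++ (val z).2.

Definition tower_letter z := head a (val z).2.

Definition climb r : seq tower := pmap insub (floors r).

Lemma val_climb r : r \in rs -> map val (climb r) = floors r.
Proof.
move=> rr; rewrite /climb pmap_filter; last exact: insubK.
apply/all_filterP/allP => q qr; rewrite isSome_insub.
by apply/flatten_mapP; exists r.
Qed.

Lemma size_climb r : r \in rs -> size (climb r) = size r.
Proof. by move=> rr; rewrite -(size_map val) val_climb// size_map size_iota. Qed.

Lemma tower_word_in z : tower_word z \in rs.
Proof.
case: z => -[p s] /= ps; have /flatten_mapP[r rr] := ps.
by rewrite floorsP => /andP[/eqP e _]; rewrite /tower_word /= e.
Qed.

Lemma mem_climb z : z \in climb (tower_word z).
Proof.
rewrite -(mem_map val_inj) val_climb ?tower_word_in//.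
case: z => -[p s] /= ps; have /flatten_mapP[r rr] := ps.
by rewrite !floorsP /tower_word /= eqxx => /andP[].
Qed.

Lemma tower_suffix_neq0 z : (val z).2 != [::].
Proof.
by have := map_f val (mem_climb z); rewrite val_climb ?tower_word_in//
  [val z]surjective_pairing floorsP => /andP[].
Qed.

Definition code v : seq tower := flatten (map climb (cut a v)).

Lemma code_cat u v : head a v == a -> code (u ++ v) = code u ++ code v.
Proof. by move=> va; rewrite /code cut_cat// map_cat flatten_cat. Qed.

Lemma code_return r : r \in rs -> code r = climb r.
Proof. by move=> /rsP[rr _]; rewrite /code cut_return//= cats0. Qed.

Lemma tower_letter_climb r : r \in rs -> map tower_letter (climb r) = r.
Proof.
move=> rr; rewrite (_ : tower_letter = (fun q : seq A * seq A => head a q.2) \o val)//.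
rewrite map_comp val_climb// /floors -map_comp -[RHS](mkseq_nth a).
by apply: eq_map => i /=; rewrite -nth0 nth_drop addn0.
Qed.

Lemma tower_letter_code v : block v -> map tower_letter (code v) = v.
Proof.
move=> /block_cut; rewrite -[in RHS](cutK a v) /code.
elim: (cut a v) => //= r c IH rc; rewrite map_cat tower_letter_climb ?IH//.
  by move=> s sc; apply: rc; rewrite inE sc orbT.
by apply: rc; rewrite mem_head.
Qed.

(** Through [Fc], a return word [r] goes to a concatenation of at least [size r]
    return words. These are dealt out to the floors of [r], one to each but the
    last, and all remaining ones to the last. *)
Definition tower_image (p s : seq A) : seq (seq A) :=
  let c := cut a (Fc (p ++ s)) in
  if size s == 1%N then drop (size p) c else [:: nth [::] c (size p)].

Lemma size_tower_word z : (size (val z).1 < size (tower_word z))%N.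
Proof.
by rewrite /tower_word size_cat -[ltnLHS]addn0 ltn_add2l lt0n size_eq0 tower_suffix_neq0.
Qed.

Lemma tower_image_sub z : {subset tower_image (val z).1 (val z).2 <= rs}.
Proof.
have rz := tower_word_in z.
have sub := block_cut (block_Fc (block_return rz)).
rewrite /tower_image -/(tower_word z); case: ifP => _ r.
  by move=> /mem_drop; exact: sub.
rewrite inE => /eqP ->; apply/sub/mem_nth.
exact: leq_trans (size_tower_word z) (Fc_long rz).
Qed.

Lemma tower_image_neq0 z : tower_image (val z).1 (val z).2 != [::].
Proof.
rewrite /tower_image -/(tower_word z); case: ifP => // _.
rewrite -size_eq0 size_drop subn_eq0 -ltnNge.
exact: leq_trans (size_tower_word z) (Fc_long (tower_word_in z)).
Qed.

Definition tower_subst_fun z : seq tower :=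
  flatten (map climb (tower_image (val z).1 (val z).2)).

Lemma climb_neq0 r : r \in rs -> climb r != [::].
Proof.
move=> rr; rewrite -size_eq0 size_climb// size_eq0.
by have /rsP[] := rr; case: r {rr}.
Qed.

Lemma climb_tower_subst z : exists2 r, r \in rs & infix (climb r) (tower_subst_fun z).
Proof.
have := @tower_image_sub z; have := tower_image_neq0 z.
rewrite /tower_subst_fun; case: (tower_image _ _) => // r c _ rc.
by exists r; [apply: rc; rewrite mem_head|exact: prefix_infix].
Qed.

Lemma tower_subst_neq0 z : tower_subst_fun z != [::].
Proof.
have [r /climb_neq0 r0 /size_infix] := climb_tower_subst z.
by rewrite -!size_eq0 -!lt0n in r0 *; exact: leq_trans.
Qed.

Definition tower_subst : substitution tower := Substitution tower_subst_neq0.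

Lemma tower_image_climb r : r \in rs ->
  flatten [seq tower_image q.1 q.2 | q <- floors r] = cut a (Fc r).
Proof.
move=> rr; have := Fc_long rr; rewrite /floors -map_comp /tower_image /=.
have /rsP[+ _] := rr; case: r rr => // b t rr _ tc.
transitivity (flatten [seq (if i == size t then drop i (cut a (Fc (b :: t)))
  else [:: nth [::] (cut a (Fc (b :: t))) i]) | i <- iota 0 (size t).+1]).
  congr flatten; apply/eq_in_map => i; rewrite mem_iota add0n ltnS => /andP[_ it] /=.
  rewrite cat_take_drop size_drop size_takel /=; last exact: leqW.
  by rewrite (_ : ((size t).+1 - i == 1%N) = (i == size t)); last lia.
rewrite -addn1 iotaD map_cat flatten_cat /= add0n eqxx cats0.
rewrite -[RHS](cat_take_drop (size t)) -(map_nth_iota0 [::] (ltnW tc)).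
rewrite -[in RHS]flatten_map1; congr (flatten _ ++ _); apply/eq_in_map => i.
by rewrite mem_iota add0n => /andP[_ it]; rewrite ltn_eqF.
Qed.

Lemma tower_subst_climb r : r \in rs ->
  subst_word tower_subst (climb r) = code (Fc r).
Proof.
move=> rr; rewrite /subst_word.
rewrite (_ : map tower_subst (climb r) =
  [seq flatten (map climb (tower_image q.1 q.2)) | q <- map val (climb r)]); last first.
  by rewrite -map_comp.
rewrite val_climb// /code -tower_image_climb//.
by elim: (floors r) => //= q s ->; rewrite map_cat flatten_cat.
Qed.

Lemma tower_subst_flatten c : {subset c <= rs} ->
  subst_word tower_subst (flatten (map climb c)) = code (Fc (flatten c)).
Proof.
elim: c => [|r c IH] rc; first by rewrite /= /Fc F0 drop_size.
have rr : r \in rs by apply: rc; rewrite mem_head.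
have {}rc : {subset c <= rs} by move=> s sc; apply: rc; rewrite inE sc orbT.
have ca : head a (flatten c) == a.
  by apply: head_flatten_return; apply/allP => s /rc /rsP[].
rewrite /= subst_word_cat IH// tower_subst_climb// Fc_cat//; last first.
  exact: (block_return rr).1.
by rewrite code_cat//; exact: head_Fc.
Qed.

Lemma tower_subst_code v : block v -> subst_word tower_subst (code v) = code (Fc v).
Proof. by move=> /block_cut /tower_subst_flatten; rewrite cutK. Qed.

Lemma iter_tower_subst_code k v : block v ->
  iter k (subst_word tower_subst) (code v) = code (iter k Fc v).
Proof.
move=> vb; elim: k => //= k ->; rewrite tower_subst_code//; exact: block_iter_Fc.
Qed.

(** The image of any letter runs through all floors over some return word [r],
    so that the second image runs through the code of [Fc r], which all return
    words enter. *)
Lemma tower_primitive : primitive tower_subst.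
Proof.
exists 2%N => // z z'.
have [r rr rz] := climb_tower_subst z.
rewrite /subst_iter /= subst_word1.
apply: (mem_infix (iter_subst_word_infix tower_subst 1 rz)).
rewrite /= tower_subst_climb//; apply/flatten_mapP; exists (tower_word z').
  by apply: Fc_all => //; exact: tower_word_in.
exact: mem_climb.
Qed.

(** [tower_subst] acts on codes as [Fc] acts on blocks, and every letter lies in the
    code of a return word. *)
Lemma tower_admitted_code u : admitted tower_subst u ->
  exists2 v, block v & infix u (code v).
Proof.
move=> [z [k uk]]; have zr := tower_word_in z; have br := block_return zr.
exists (iter k Fc (tower_word z)); first exact: block_iter_Fc.
apply: infix_trans uk _; rewrite -iter_tower_subst_code// code_return//.
by apply: iter_subst_word_infix; rewrite infix1s mem_climb.
Qed.

(** Iterated images of a return word under [Fc] get long, so by recurrence one of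
    them contains [rcons v a]. The cuts before [v] and before the final [a] are
    then also cuts of this image, whose code thus contains that of [v]. *)
Lemma code_tower_admitted v : block v -> v != [::] -> admitted tower_subst (code v).
Proof.
move=> vb v0; have [M MP] := L_recurrent (proj2 vb).
have [r rr] : exists r, r \in rs.
  have := block_cut vb; rewrite -(cut_eq0 a) in v0.
  by case: (cut a v) v0 => // r c _ rc; exists r; apply: rc; rewrite mem_head.
have [z _] : exists z, z \in climb r.
  by case: (climb r) (climb_neq0 rr) => // z s _; exists z; rewrite mem_head.
have [r' rr' zr'] := climb_tower_subst z.
have br' := block_return rr'.
have r'0 : r' != [::] by have /rsP[] := rr'; case: (r').
have [bV LV] := block_iter_Fc M br'.
have sV := size_iter_Fc M br' r'0.
exists z, M.+1; rewrite /subst_iter iterSr subst_word1.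
apply: infix_trans (iter_subst_word_infix tower_subst M zr').
rewrite -code_return// iter_tower_subst_code//.
have LV' : L (iter M Fc r') by apply: L_infix LV; exact: infix_rcons.
have /infixP[X [Y ->]] := MP _ LV' (ltnW sV).
rewrite -cats1 -catA code_cat; last by case: (v) v0 (proj1 vb).
by rewrite code_cat//=; exact: infix_infix.
Qed.

(** * Reading the tower off a bi-infinite word *)

(** The word has the return word of [z] followed by the letter [a], with the
    marked position at [j]; the default value of [nth] is that last [a]. *)
Definition stands_on (w : fullshift A) (j : int) z :=
  forall k, (k <= size (tower_word z))%N ->
    w (j - (size (val z).1)%:Z + k%:Z)%R = nth a (tower_word z) k.

(** The case [k = size r] is that of the default value. *)
Lemma return_nth_eq r k : r \in rs -> (k <= size r)%N ->
  (nth a r k == a) = (k == 0%N) || (k == size r).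
Proof.
move=> /rsP[+ _]; case: r => //= b t /andP[/eqP -> at_].
case: k => [|k] /=; first by rewrite eqxx.
rewrite ltnS eqSS leq_eqVlt => /predU1P[->|kt]; first by rewrite nth_default// !eqxx.
by rewrite (ltn_eqF kt); apply/negbTE; apply: contra at_ => /eqP <-; exact: mem_nth.
Qed.

(** The occurrences of [a] closest to [j], on the left and on the right, delimit
    the return word. *)
Lemma stands_on_inj w j z z' : stands_on w j z -> stands_on w j z' -> z = z'.
Proof.
have le1 z1 z2 : stands_on w j z1 -> stands_on w j z2 ->
    (size (val z1).1 <= size (val z2).1)%N.
  move=> s1 s2; rewrite leqNgt; apply/negP => lt.
  have l1 := size_tower_word z1; have r1 := tower_word_in z1.
  have l3 : (size (val z1).1 - size (val z2).1 < size (tower_word z1))%N.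
    exact: leq_ltn_trans (leq_subr _ _) l1.
  have := s1 _ (ltnW l3).
  have := return_nth_eq (tower_word_in z2) (leq0n _); rewrite eqxx /=.
  rewrite -(s2 0%N)// => /eqP e2 e1.
  have := return_nth_eq r1 (ltnW l3).
  rewrite -e1 -subzn ?(ltnW lt)// GRing.addr0 in e2 *.
  rewrite GRing.addrA GRing.subrK e2 eqxx subn_eq0 leqNgt lt (ltn_eqF l3).
  by [].
have le2 z1 z2 : size (val z1).1 = size (val z2).1 ->
    stands_on w j z1 -> stands_on w j z2 ->
    (size (tower_word z1) <= size (tower_word z2))%N.
  move=> e s1 s2; rewrite leqNgt; apply/negP => lt.
  have := s1 _ (ltnW lt); rewrite e s2// nth_default// => /esym/eqP.
  rewrite (return_nth_eq (tower_word_in z1) (ltnW lt)) (ltn_eqF lt) orbF.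
  by rewrite gtn_eqF//; exact: leq_ltn_trans (size_tower_word z2).
move=> s1 s2.
have ep : size (val z).1 = size (val z').1 by apply/eqP; rewrite eqn_leq !le1.
have er : tower_word z = tower_word z'.
  apply: (@eq_from_nth _ a) => [|k kz]; first by apply/eqP; rewrite eqn_leq !le2.
  rewrite -s1 ?(ltnW kz)// ep s2//.
  by apply: leq_trans (ltnW kz) _; exact: le2.
apply: val_inj; rewrite [LHS]surjective_pairing [RHS]surjective_pairing.
congr pair.
  by rewrite -(take_size_cat (val z).2 ep) -/(tower_word z) er take_size_cat.
by rewrite -(drop_size_cat (val z).2 ep) -/(tower_word z) er drop_size_cat.
Qed.

Lemma nth_code z0 v j : block v -> (j < size v)%N ->
  let z := nth z0 (code v) j in
  exists v1 v2, [/\ v = v1 ++ tower_word z ++ v2, head a v2 == a &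
                    j = (size v1 + size (val z).1)%N].
Proof.
move=> vb; suff nth_climb c : all (return_shape a) c -> {subset c <= rs} ->
    forall j, (j < size (flatten c))%N ->
    let z := nth z0 (flatten (map climb c)) j in
    exists v1 v2, [/\ flatten c = v1 ++ tower_word z ++ v2, head a v2 == a &
                      j = (size v1 + size (val z).1)%N].
  have := nth_climb _ (cut_return_shape vb.1) (block_cut vb) j.
  by rewrite cutK; apply.
elim: c => [//|r c IH /= /andP[rS cS] rc {}j].
rewrite size_cat nth_cat size_climb ?rc ?mem_head//.
have rr : r \in rs by rewrite rc ?mem_head.
case: (ltnP j (size r)) => jr jrc.
  have zE : val (nth z0 (climb r) j) = (take j r, drop j r).
    rewrite -(nth_map _ (val z0)) ?size_climb// val_climb// (nth_map 0%N) ?size_iota//.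
    by rewrite nth_iota.
  exists [::], (flatten c); split; last 1 first.
  - by have /= -> := congr1 (fun q => size q.1) zE; rewrite size_takel// ltnW.
  - by rewrite /tower_word zE /= cat_take_drop.
  - exact: head_flatten_return.
have [||v1 [v2 [e v2a ej]]] := IH cS _ (j - size r)%N.
- by move=> s sc; apply: rc; rewrite inE sc orbT.
- by rewrite ltn_subLR.
exists (r ++ v1), v2; split=> //; first by rewrite [in LHS]e -!catA.
by rewrite size_cat -addnA -ej subnKC.
Qed.

Lemma stands_on_code z0 w i v :
    (forall k, (k <= size v)%N -> w (i + k%:Z)%R = nth a v k) -> block v ->
  forall k, (k < size v)%N -> stands_on w (i + k%:Z)%R (nth z0 (code v) k).
Proof.
move=> wv vb k kv; have [v1 [v2 [e v2a ek]]] := nth_code z0 vb kv.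
move: (nth z0 (code v) k) e ek => z e ek m mz.
have -> : (i + k%:Z - (size (val z).1)%:Z + m%:Z = i + (size v1 + m)%:Z)%R by lia.
rewrite wv; last first.
  by rewrite [in leqRHS]e size_cat leq_add2l size_cat; exact: leq_trans mz (leq_addr _ _).
rewrite e nth_cat ltnNge leq_addr /= addKn nth_cat.
case: ltnP => // zm; have -> : m = size (tower_word z).
  by apply/eqP; rewrite eqn_leq mz zm.
by rewrite subnn nth0 nth_default//; exact/eqP.
Qed.

Lemma stands_on_letter w j z : stands_on w j z -> w j = tower_letter z.
Proof.
move=> /(_ _ (ltnW (size_tower_word z))); rewrite GRing.subrK => ->.
by rewrite /tower_word nth_cat ltnn subnn nth0.
Qed.

Definition tower_factor (t : fullshift tower) : fullshift A :=
  fun j => tower_letter (t j).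

Lemma tower_factor_language t : subshift tower_subst t ->
  forall i n, L (subword (tower_factor t) i n).
Proof.
move=> Xt i n; have [v vb /infixP[u1 [u2 e]]] := tower_admitted_code (Xt i n).
apply: L_infix (L_infix (infix_rcons _ _) vb.2).
rewrite -(tower_letter_code vb) e !map_cat.
suff -> : map tower_letter (subword t i n) = subword (tower_factor t) i n.
  exact: infix_infix.
by rewrite /subword /mkseq -map_comp.
Qed.

Lemma nth_cat_head r v k : head a v == a -> (k <= size r)%N ->
  nth a (r ++ v) k = nth a r k.
Proof.
move=> va kr; rewrite nth_cat; case: ltnP => // rk.
have -> : k = size r by apply/eqP; rewrite eqn_leq kr.
by rewrite subnn nth0 nth_default//; exact/eqP.
Qed.

(** A window of a point of the tower subshift around [j] lies in the code of a
    word; one that is wide enough shows the whole return word at [j] and the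
    beginning of the next one. *)
Lemma tower_factor_stands_on t : subshift tower_subst t ->
  forall j, stands_on (tower_factor t) j (t j).
Proof.
move=> Xt j m mz; pose M := \max_(r <- rs) size r.
have rM : (size (tower_word (t j)) <= M)%N.
  by apply: (@leq_bigmax_seq _ rs xpredT size) => //; exact: tower_word_in.
have pM := size_tower_word (t j).
have [v vb /infixP[u1 [u2 e]]] := tower_admitted_code (Xt (j - M%:Z)%R (M + M).+1).
have windowE o : (o <= M + M)%N ->
    nth (t j) (code v) (size u1 + o) = t (j - M%:Z + o%:Z)%R.
  move=> oM; rewrite e nth_cat ltnNge leq_addr addKn.
  by rewrite nth_cat size_subword ltnS oM nth_mkseq.
have sv : size (code v) = size v by rewrite -[in RHS](tower_letter_code vb) size_map.
have uv o : (o <= M + M)%N -> (size u1 + o < size v)%N.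
  move=> oM; rewrite -sv e !size_cat size_subword ltn_add2l.
  by apply: leq_trans (leq_addr _ _); rewrite ltnS.
have [v1 [v2 []]] := nth_code (t j) vb (uv M (leq_addr _ _)).
rewrite windowE ?leq_addr// GRing.subrK => ve v2a pe.
have -> : (j - (size (val (t j)).1)%:Z + m%:Z =
    j - M%:Z + (M - size (val (t j)).1 + m)%N%:Z)%R by lia.
have oM : (M - size (val (t j)).1 + m <= M + M)%N by lia.
rewrite /tower_factor -windowE// -(nth_map _ a) ?sv ?uv//.
rewrite tower_letter_code//.
have -> : (size u1 + (M - size (val (t j)).1 + m) = size v1 + m)%N by lia.
by rewrite ve nth_cat ltnNge leq_addr /= addKn nth_cat_head.
Qed.

Hypothesis La : L [:: a].

(** By recurrence an [a] occurs shortly before [i] and another one shortly after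
    [i + n]. *)
Lemma covering_block w i n : (forall i n, L (subword w i n)) ->
  exists i0 v, [/\ (i0 <= i)%R, (i + n%:Z <= i0 + (size v)%:Z)%R, block v &
    forall k, (k <= size v)%N -> w (i0 + k%:Z)%R = nth a v k].
Proof.
move=> Lw; have [M MP] := L_recurrent La.
have near_a j : exists2 k, (k < M)%N & w (j + k%:Z)%R = a.
  have := MP _ (Lw j M); rewrite size_subword => /(_ (leqnn _)).
  move=> /infix_subwordP[k /=]; rewrite addn1 => kM [] <-.
  by exists k; rewrite ?GRing.addr0.
have [k kM wk] := near_a (i - M%:Z)%R.
have [l lM wl] := near_a (i + n%:Z)%R.
pose i0 := (i - M%:Z + k%:Z)%R; pose m := (M - k + n + l)%N.
have wm : w (i0 + m%:Z)%R = a by rewrite -wl; congr w; rewrite /i0 /m; lia.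
have m0 : (0 < m)%N by rewrite /m; lia.
exists i0, (subword w i0 m); rewrite size_subword.
split; [by rewrite /i0; lia|by rewrite /i0 /m; lia|split|].
- by rewrite -nth0 nth_mkseq// GRing.addr0 wk.
- by rewrite -{1}wm -mkseqS; exact: (Lw i0 m.+1).
- move=> q; rewrite leq_eqVlt => /predU1P[->|qm]; last by rewrite nth_mkseq.
  by rewrite wm nth_default// size_subword.
Qed.

Lemma tower_lift w : (forall i n, L (subword w i n)) ->
  exists2 t, subshift tower_subst t & forall j, stands_on w j (t j).
Proof.
move=> Lw; have size_code v : block v -> size (code v) = size v.
  by move=> vb; rewrite -[in RHS](tower_letter_code vb) size_map.
have ex j : exists z, stands_on w j z.
  have [i0 [v [i0j jv vb wv]]] := covering_block j 1 Lw.
  have jv' : (`|(j - i0)%R| < size v)%N by lia.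
  have [z0 _] : exists z0, z0 \in code v.
    move: jv'; rewrite -size_code//; case: (code v) => [|z0 c] //.
    by exists z0; rewrite mem_head.
  have := @stands_on_code z0 _ _ _ wv vb _ jv'.
  have -> : (i0 + `|(j - i0)%R|%N%:Z = j)%R by lia.
  by exists (nth z0 (code v) `|(j - i0)%R|%N).
have [t tP] := choice ex; exists t => // i n.
have [i0 [v [i0i iv vb wv]]] := covering_block i n.+1 Lw.
have codeE : code v = subword t i0 (size v).
  apply: (@eq_from_nth _ (t 0%R)) => [|k]; rewrite size_code// ?size_subword// => kv.
  rewrite nth_mkseq//.
  exact: stands_on_inj (stands_on_code wv vb kv) (tP _).
apply: admitted_infix (code_tower_admitted vb _).
  by rewrite codeE; apply: subword_infix => //; lia.
by apply/eqP => v0; rewrite v0 /= in iv; lia.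
Qed.

(** Both maps are sliding block codes: the tower letter at [j] is found in the
    window occupied by its return word and the next letter. *)
Lemma tower_conjugate (phi : substitution A) :
    (forall w, subshift phi w <-> forall i n, L (subword w i n)) ->
  topologically_conjugate (@sigma tower tower_subst) (@sigma A phi).
Proof.
move=> XL.
have fX (t : subshift tower_subst) : subshift phi (tower_factor (set_val t)).
  by apply/XL/tower_factor_language; exact: set_valP.
pose f (t : subshift tower_subst) : subshift phi := SigSub (mem_set (fX t)).
have ex (w : subshift phi) : exists t : subshift tower_subst,
    forall j, stands_on (set_val w) j (set_val t j).
  have [t Xt tP] := tower_lift ((XL _).1 (set_valP w)).
  by exists (SigSub (mem_set Xt)).
have [g gP] := choice ex.
exists f, g; split.
- move=> t; apply: val_inj; apply/funext => j.
  apply: stands_on_inj (gP (f t) j) _; apply: tower_factor_stands_on.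
  exact: set_valP.
- move=> w; apply: val_inj; apply/funext => j.
  exact: esym (stands_on_letter (gP w j)).
- apply: local_continuous => t j; exists j, 1%N => t' [].
  by rewrite GRing.addr0 => /(congr1 tower_letter).
- apply: local_continuous => w j; set z := set_val (g w) j.
  exists (j - (size (val z).1)%:Z)%R, (size (tower_word z)).+1 => w' e.
  apply: stands_on_inj (gP w' j) _ => k kz; rewrite -(gP w j)//.
  have := congr1 (fun u => nth a u k) e.
  by rewrite !nth_mkseq.
- by move=> t; apply: val_inj; apply/funext => j.
Qed.

End Tower.

(** * The conjugacy theorem *)

Lemma recurrent_seq (A : finType) (L : seq A -> Prop) (us : seq (seq A)) :
    (forall u, L u -> exists M, forall v, L v -> (M <= size v)%N -> infix u v) ->
    (forall u, u \in us -> L u) ->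
  exists M, forall v, L v -> (M <= size v)%N -> forall u, u \in us -> infix u v.
Proof.
move=> rec; elim: us => [|u us IH] Lus; first by exists 0%N.
have [M1 M1P] := rec u (Lus u (mem_head _ _)).
have [|M2 M2P] := IH; first by move=> v vus; apply: Lus; rewrite inE vus orbT.
exists (M1 + M2)%N => v Lv Mv w; rewrite inE => /predU1P[->|].
  by apply: M1P => //; apply: leq_trans Mv; exact: leq_addr.
by apply: M2P => //; apply: leq_trans Mv; exact: leq_addl.
Qed.

(** A return word longer than [M] would contain a word of length [M] without
    [a]. *)
Lemma return_words (A : finType) (a : A) (L : seq A -> Prop) (M : nat) :
    (forall u v, infix u v -> L v -> L u) ->
    (forall v, L v -> (M <= size v)%N -> infix [:: a] v) ->
  exists2 rs : seq (seq A),
    forall r, r \in rs <-> return_shape a r /\ L (rcons r a) &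
    forall r, r \in rs -> (size r <= M)%N.
Proof.
move=> L_infix MP; have [s sP] := bounded_words A M.
have short r : return_shape a r -> L (rcons r a) -> (size r <= M)%N.
  case: r => //= b t /andP[_ at_] Lr; rewrite ltnNge; apply/negP => Mt.
  have Lt : L t.
    by apply: L_infix Lr; rewrite -cats1; exact: (infix_infix [:: b]).
  by have := MP t Lt Mt; rewrite infix1s (negPf at_).
exists [seq r <- s | `[< return_shape a r /\ L (rcons r a) >]] => [r|r].
  rewrite mem_filter sP; split=> [/andP[/asboolP]//|[rr Lr]].
  by rewrite short// andbT; apply/asboolP.
by rewrite mem_filter sP => /andP[].
Qed.

Section Main.
Variables (A : finType) (phi : substitution A).
Hypothesis phi_minimal : minimal_substitution phi.
Local Notation L := (language (subshift phi)).

(** Here [f] preserves the language of [phi] but may define another subshift; so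
    a constant substitution can stand in for [phi], as in
    [unbounded_language_substitution]. *)
Lemma conjugate_to_primitive (f : substitution A) (a : A) :
    (forall u, L u -> L (subst_word f u)) -> L [:: a] -> unbounded f a ->
  exists (Z : finType) (theta : substitution Z),
    primitive theta /\
    topologically_conjugate (@sigma Z theta) (@sigma A phi).
Proof.
move=> fL La fa.
have L_infix u v : infix u v -> L v -> L u by exact: language_infix.
have L_rec u : L u -> exists M, forall v, L v -> (M <= size v)%N -> infix u v.
  exact: uniformly_recurrent.
have [M MP] := L_rec _ La.
have [rs rsP rsM] := return_words L_infix MP.
have [K KP] : exists K, forall v, L v -> (K <= size v)%N ->
    forall u, u \in [seq rcons r a | r <- rs] -> infix u v.
  by apply: recurrent_seq L_rec _ => _ /mapP[r /rsP[_ Lr] ->].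
(* Images longer than [K] contain all return words, and those longer than [M * M]
   consist of more than [M] of them, as each has length at most [M]. *)
have [p pP] := fa (K + M * M + M).+1.
pose F u := iter p (subst_word f) u.
have F_cat u v : F (u ++ v) = F u ++ F v by exact: iter_subst_word_cat.
have F_L u : L u -> L (F u) by rewrite /F => Lu; elim: (p) => //= k; exact: fL.
have F_size r : r \in rs -> (K + M * M + M < size (F r))%N.
  move=> /rsP[+ _]; case: r => //= b t /andP[/eqP -> _].
  by rewrite -cat1s F_cat size_cat; apply: leq_trans (leq_addr _ _).
have [x [y Fa]] : exists x y, F [:: a] = x ++ a :: y.
  have /MP : L (F [:: a]) by exact: F_L.
  rewrite infix1s => H; have : a \in F [:: a].
    by apply: H; move: pP; rewrite /F /subst_iter; lia.
  by case/splitPr => x y; exists x, y.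
have Fc_block r : r \in rs -> block a L (Fc F x r).
  by move=> rr; exact (block_Fc L_infix F_cat F_L Fa (block_return rsP rr)).
have Fc_size r : r \in rs -> (K + M * M + M < size (Fc F x r))%N.
  by move=> rr; rewrite (size_Fc F_cat Fa) ?F_size//; case: (block_return rsP rr).
have Fc_all r r' : r \in rs -> r' \in rs -> r' \in cut a (Fc F x r).
  move=> rr rr'; have [ca Lc] := Fc_block r rr.
  have /infixP[X [Y ->]] : infix (rcons r' a) (Fc F x r).
    apply: KP; last exact: map_f.
      exact: L_infix (infix_rcons _ _) Lc.
    by have := Fc_size r rr; lia.
  have [r'S _] := (rsP r').1 rr'.
  rewrite -cats1 -catA cut_cat.
    by rewrite cut_cat //= mem_cat mem_cat (cut_return r'S) mem_head orbT.
  by case: (r') r'S => //= b t /andP[].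
have Fc_long r : r \in rs -> (size r <= size (cut a (Fc F x r)))%N.
  move=> rr; rewrite leqNgt; apply/negP => lt.
  have := Fc_size r rr; rewrite ltnNge => /negP; apply.
  have sub := block_cut L_infix rsP (Fc_block r rr).
  rewrite -{1}(cutK a (Fc F x r)).
  have : (size (flatten (cut a (Fc F x r))) <= size (cut a (Fc F x r)) * M)%N.
    elim: (cut a _) sub => //= s c IH sc; rewrite size_cat mulSn leq_add//.
      by apply: rsM; apply: sc; rewrite mem_head.
    by apply: IH => q qc; apply: sc; rewrite inE qc orbT.
  move/leq_trans; apply.
  have : (size (cut a (Fc F x r)) * M <= M * M)%N.
    by rewrite leq_mul2r (leq_trans (ltnW lt) (rsM r rr)) orbT.
  by move/leq_trans; apply; lia.
have F_grow r : r \in rs -> (size r < size (F r))%N.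
  by move=> rr; have := rsM r rr; have := F_size r rr; lia.
exists (tower rs), (tower_subst L_infix rsP F_cat F_L Fa Fc_long); split.
  exact: tower_primitive.
apply: tower_conjugate => // w; exact: subshift_language.
Qed.

End Main.

Theorem theorem2p1 (A : finType) (phi : substitution A)
    (phi_minimal : minimal_substitution phi)
    (X_neq0 : subshift phi !=set0) :
  exists (Z : finType) (theta : substitution Z),
    primitive theta /\
    topologically_conjugate (@sigma Z theta) (@sigma A phi).
Proof.
have [f [a [fL La fa]]] := unbounded_language_substitution X_neq0.
exact: conjugate_to_primitive fL La fa.
Qed.
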